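(* For every integer $n \geq 1$, $\mathrm{ex}(n, C) < \frac{5n}{3}$, where $C$ is the crown; that is, every crown-free linear $3$-graph on $n$ vertices has strictly fewer than $\frac{5n}{3}$ edges.
   Context: A linear $3$-graph $H$ is a non-empty set $V(H)$ of vertices together with a set $E(H)$ of $3$-element subsets of $V(H)$, called edges, such that any two distinct edges intersect in at most one vertex. The crown $C$ is the linear $3$-graph consisting of three pairwise disjoint edges (called jewels) together with a fourth edge (called the base) intersecting all three jewels; thus it has $9$ vertices and $4$ edges, and the base meets each jewel in exactly one vertex. A linear $3$-graph is crown-free if it has no subgraph isomorphic to $C$. For a linear $3$-graph $F$, the linear Turán number $\mathrm{ex}(n,F)$ is the greatest number of edges in any linear $3$-graph on $n$ vertices that has no subgraph isomorphic to $F$. *)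

(* Defs.v *)
From mathcomp Require Import all_boot all_order all_algebra.

Set Implicit Arguments.
Unset Strict Implicit.
Unset Printing Implicit Defensive.

(* A graph is given by a finType [V] of vertices and its edge set [E]. *)
Definition linear3graph (V : finType) (E : {set {set V}}) : bool :=
  [&& 0 < #|V|,
      [forall e in E, #|e| == 3] &
      [forall e1 in E, forall e2 in E, (e1 != e2) ==> (#|e1 :&: e2| <= 1)]].

(* The copy of [F] under an injection [f] has vertex set [f @: W] and edge set
   [[set f @: e | e in F]]; it is a subgraph of [E] when the latter is included
   in [E]. Subgraphs need not be induced. *)
Definition contains_copy (V W : finType) (E : {set {set V}})
    (F : {set {set W}}) : bool :=
  [exists f : {ffun W -> V},
     injectiveb f && ([set f @: e | e : {set W} in F] \subset E)].

Definition copy_free (V W : finType) (F : {set {set W}}) (E : {set {set V}}) : bool :=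
  ~~ contains_copy E F.

(* Every graph on n vertices is isomorphic to one on ['I_n]. *)
Definition linear_turan (W : finType) (n : nat) (F : {set {set W}}) : nat :=
  \max_(E : {set {set 'I_n}} | linear3graph E && copy_free F E) #|E|.

Definition crown_vertex (k : nat) : 'I_9 := inord k.

(* Jewels 012, 345, 678 and base 036. *)
Definition crown : {set {set 'I_9}} :=
  let v := crown_vertex in
  [set [set v 0; v 1; v 2];
       [set v 3; v 4; v 5];
       [set v 6; v 7; v 8];
       [set v 0; v 3; v 6]].

(* Main.v *)
(* Give each edge the weight equal to the sum of 1/d(v) over its vertices v; the
   weights add up to the number of non-isolated vertices. Choosing jewels
   greedily, an edge whose degrees are at least 2, 4 and 6 is the base of a
   crown, so in a crown-free graph every edge has weight at least 3/5, with
   equality only for degrees 5, 5, 5. Hence 3/5 |E| <= n, and equality would make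
   the graph 5-regular on its edges. In that case the three vertices of an edge
   have the same closed neighbourhood, so every component is a Steiner triple
   system on 11 points, which does not exist. *)
Require Import Defs.
From mathcomp Require Import all_boot all_order all_algebra.
From mathcomp Require Import zify lra.

Set Implicit Arguments.
Unset Strict Implicit.
Unset Printing Implicit Defensive.

Import Order.TTheory GRing.Theory Num.Theory.

(** * Degrees, neighbourhoods and triples *)

Definition degree (V : finType) (E : {set {set V}}) (v : V) : nat :=
  #|[set e in E | v \in e]|.

(** Contains [v] itself exactly when some edge passes through [v]; for an isolated vertex it is
    empty. *)
Definition closed_nbhd (V : finType) (E : {set {set V}}) (v : V) : {set V} :=
  [set w | [exists e in E, (v \in e) && (w \in e)]].

Lemma card3_setD1 (T : finType) (A : {set T}) (a : T) :
  #|A| = 3 -> a \in A -> #|A :\ a| = 2.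
Proof.
by move=> A3 aA; have := cardsD1 a A; rewrite aA A3 add1n => -[].
Qed.

Lemma card3_remove (T : finType) (A : {set T}) (a : T) :
  #|A| = 3 -> a \in A -> exists x y, uniq [:: a; x; y] /\ A = [set a; x; y].
Proof.
move=> A3 aA; have /eqP/cards2P := card3_setD1 A3 aA.
move=> [x [y [xy Axy]]]; exists x, y.
have : x \in A :\ a by rewrite Axy !inE eqxx.
have : y \in A :\ a by rewrite Axy !inE eqxx orbT.
rewrite !inE => /andP[ya _] /andP[xa _]; split.
  by rewrite /= !inE negb_or ![a == _]eq_sym xa ya xy.
by rewrite -[LHS](setD1K aA) Axy setUA.
Qed.

Lemma edge_card (V : finType) (E : {set {set V}}) (e : {set V}) :
  linear3graph E -> e \in E -> #|e| = 3.
Proof. by case/and3P=> _ /forall_inP E3 _ /E3/eqP. Qed.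

Lemma linear_edge_eq (V : finType) (E : {set {set V}}) (e f : {set V}) (u v : V) :
  linear3graph E -> e \in E -> f \in E -> u != v ->
  u \in e -> v \in e -> u \in f -> v \in f -> e = f.
Proof.
case/and3P=> _ _ /forall_inP lin eE fE uv ue ve uf vf; apply/eqP.
apply: contraTT (forall_inP (lin e eE) f fE) => ef; rewrite ef /= -ltnNge.
rewrite -[2](_ : #|[set u; v]| = 2); last by rewrite cards2 uv.
by apply/subset_leq_card/subsetP => x /set2P[]->; rewrite inE ?ue ?uf ?ve ?vf.
Qed.

(** * Crowns forced by degree conditions *)

Lemma crown_copy (V : finType) (E : {set {set V}}) (A B C : {set V}) (a b c : V) :
  linear3graph E -> A \in E -> B \in E -> C \in E -> [set a; b; c] \in E ->
  a \in A -> b \in B -> c \in C ->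
  [disjoint A & B] -> [disjoint A & C] -> [disjoint B & C] ->
  contains_copy E crown.
Proof.
move=> lE AE BE CE eE aA bB cC dAB dAC dBC.
have [a1 [a2 [uA defA]]] := card3_remove (edge_card lE AE) aA.
have [b1 [b2 [uB defB]]] := card3_remove (edge_card lE BE) bB.
have [c1 [c2 [uC defC]]] := card3_remove (edge_card lE CE) cC.
(* The order matches the labels of [crown]: positions 0, 3 and 6 carry the base, and each
   consecutive triple is a jewel. *)
pose s := [:: a; a1; a2; b; b1; b2; c; c1; c2].
have memA x : (x \in [:: a; a1; a2]) = (x \in A) by rewrite defA !inE orbA.
have memB x : (x \in [:: b; b1; b2]) = (x \in B) by rewrite defB !inE orbA.
have memC x : (x \in [:: c; c1; c2]) = (x \in C) by rewrite defC !inE orbA.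
have us : uniq s.
  rewrite -[s]/([:: a; a1; a2] ++ [:: b; b1; b2] ++ [:: c; c1; c2]).
  rewrite !cat_uniq uA uB uC has_cat negb_or !andTb andbT -andbA; apply/and3P; split.
  - by apply/hasPn => x; rewrite /= memB memA => /(disjointFl dAB)->.
  - by apply/hasPn => x; rewrite /= memC memA => /(disjointFl dAC)->.
  - by apply/hasPn => x; rewrite /= memC memB => /(disjointFl dBC)->.
apply/existsP; exists [ffun i : 'I_9 => nth a s i]; apply/andP; split.
  apply/injectiveP => i j; rewrite !ffunE => /eqP.
  by rewrite nth_uniq // => /eqP/val_inj.
have fv k : k < 9 -> [ffun i : 'I_9 => nth a s i] (crown_vertex k) = nth a s k.
  by move=> k9; rewrite ffunE inordK.
apply/subsetP => X /imsetP[e + ->]; rewrite !inE -!orbA.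
by case/or4P=> /eqP->; rewrite !imsetU !imset_set1 !fv //= -?defA -?defB -?defC.
Qed.

(** Two edges through [c] share only [c], which is outside [X], so each vertex of [X] blocks at most
    one of them. Together with [e] itself, at most [#|X|.+1] edges are excluded. *)
Lemma avoiding_edge (V : finType) (E : {set {set V}}) (e X : {set V}) (c : V) :
  linear3graph E -> c \notin X -> #|X|.+1 < degree E c ->
  exists f, [/\ f \in E, c \in f, f != e & [disjoint f & X]].
Proof.
move=> lE cX ltX; pose F := [set f in E | c \in f] :\ e.
have [/existsP[f]|none] := boolP [exists f, (f \in F) && [disjoint f & X]].
  by rewrite !inE => /andP[/and3P[fe fE cf] dfX]; exists f.
have hit f : f \in F -> exists2 x, x \in f & x \in X.
  move=> fF; move/existsPn: none => /(_ f); rewrite fF /= => /pred0Pn[x].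
  by case/andP=> xf xX; exists x.
pose g (f : {set V}) := odflt c [pick x in f :&: X].
have gP f : f \in F -> (g f \in f) && (g f \in X).
  move=> fF; rewrite /g; case: pickP => [x|none_x]; first by rewrite inE.
  by have [x xf xX] := hit f fF; have:= none_x x; rewrite inE xf xX.
have : #|F| <= #|X|.
  rewrite -(@card_in_imset _ _ g F).
    apply/subset_leq_card/subsetP => x /imsetP[f fF ->].
    by case/andP: (gP f fF).
  move=> f f' fF f'F eqg.
  case/andP: (gP f fF) => gf gX; case/andP: (gP f' f'F) => gf' _.
  move: fF f'F; rewrite !inE => /and3P[_ fE cf] /and3P[_ f'E cf'].
  apply: (linear_edge_eq lE fE f'E (u := c) (v := g f)) => //; last by rewrite eqg.
  by apply: contraNneq cX => ->.
have leF : degree E c <= #|F|.+1.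
  by rewrite /degree (cardsD1 e) -/F; case: (e \in _); rewrite ?add1n ?add0n.
by rewrite leqNgt -ltnS (leq_trans ltX leF).
Qed.

(* Starting from [A], choose [B] at [b] avoiding [A], then [C] at [c] avoiding
   both; the vertices [W] of [A] known not to be neighbours of [c] need not be
   counted among the obstacles to [C]. *)
Lemma extend_to_crown (V : finType) (E : {set {set V}}) (A W : {set V}) (a b c : V) :
  linear3graph E -> uniq [:: a; b; c] -> [set a; b; c] \in E ->
  A \in E -> A != [set a; b; c] -> a \in A ->
  W \subset A :\ a -> [disjoint W & closed_nbhd E c] ->
  3 < degree E b -> 5 - #|W| < degree E c ->
  contains_copy E crown.
Proof.
move=> lE; set e := [set a; b; c] => uabc eE AE Ae aA WA dW db dc.
have [ae be ce] : [/\ a \in e, b \in e & c \in e] by rewrite !inE !eqxx !orbT.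
move: uabc; rewrite /= !inE negb_or andbT => /andP[/andP[ab ac] bc].
have off f u v : f \in E -> f != e -> u != v -> u \in e -> v \in e ->
    u \in f -> v \notin f.
  move=> fE fe uv ue ve uf; apply: contra fe => vf.
  by apply/eqP; apply: (linear_edge_eq lE fE eE uv).
have bA : b \notin A by apply: (off A a).
have cA : c \notin A by apply: (off A a).
have cA2 : #|A :\ a| = 2 by rewrite card3_setD1 ?(edge_card lE AE).
have [| |B [BE bB Be dBA]] := @avoiding_edge V E e (A :\ a) b lE.
- by rewrite inE (negPf bA) andbF.
- by rewrite cA2.
have cB2 : #|B :\ b| = 2 by rewrite card3_setD1 ?(edge_card lE BE).
have aB : a \notin B by apply: (off B b); rewrite // eq_sym.
have cB : c \notin B by apply: (off B b).
have [| |C [CE cC Ce dCX]] :=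
  @avoiding_edge V E e ((A :\ a) :\: W :|: B :\ b) c lE.
- by rewrite !inE (negPf cA) (negPf cB) !andbF.
(* At most [2 - #|W|] obstacles come from [A] and 2 from [B]; excluding the base adds one, giving
   [5 - #|W|]. As [#|W| <= 2], no subtraction is truncated. *)
- have := leq_card_setU ((A :\ a) :\: W) (B :\ b).
  rewrite cardsDS // cA2 cB2 => leX; apply: leq_ltn_trans dc.
  have := subset_leq_card WA; rewrite cA2 => leW.
  apply: leq_ltn_trans leX _; by move: #|W| leW => [|[|[|k]]].
have aC : a \notin C by apply: (off C c); rewrite // eq_sym.
have bC : b \notin C by apply: (off C c); rewrite // eq_sym.
have notX x : x \in C -> x \notin (A :\ a) :\: W :|: B :\ b.
  by move=> xC; rewrite (disjointFr dCX xC).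
apply: (crown_copy lE AE BE CE eE aA bB cC); apply/pred0P => x /=.
- apply/negP => /andP[xA xB]; have := disjointFr dBA xB.
  by rewrite !inE xA andbT => /negbFE/eqP xa; rewrite -xa xB in aB.
- apply/negP => /andP[xA xC]; move: (notX x xC); rewrite !inE xA andbT !negb_or.
  (* A common vertex in [W] would be a neighbour of [c] through [C]. *)
  case/andP=> + _; rewrite negb_and !negbK => /orP[xW|/eqP xa].
    have /negP[] := negbT (disjointFr dW xW); rewrite inE.
    by apply/exists_inP; exists C; rewrite // cC.
  by rewrite -xa xC in aC.
- apply/negP => /andP[xB xC]; move: (notX x xC); rewrite !inE xB andbT !negb_or.
  by case/andP=> _ /negPn/eqP xb; rewrite -xb xC in bC.
Qed.

(** The first jewel must only differ from the base, the second must also avoid two vertices, the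
    third four: hence degrees 2, 4 and 6. *)
Lemma crown_of_degrees (V : finType) (E : {set {set V}}) (a b c : V) :
  linear3graph E -> uniq [:: a; b; c] -> [set a; b; c] \in E ->
  1 < degree E a -> 3 < degree E b -> 5 < degree E c ->
  contains_copy E crown.
Proof.
move=> lE uabc eE da db dc.
have [| |A [AE aA Ae _]] := @avoiding_edge V E [set a; b; c] set0 a lE.
- by rewrite inE.
- by rewrite cards0.
apply: (@extend_to_crown V E A set0 a b c lE uabc eE AE Ae aA) => //.
- exact: sub0set.
- by apply/pred0P => x /=; rewrite inE.
- by rewrite cards0.
Qed.

(** * The 5-regular case *)

(** A neighbour [w] of [a] that is not a neighbour of [c] cannot obstruct the jewel at [c]. Taking
    the edge through [a] and [w] as first jewel leaves three obstacles there, so degree 5 already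
    yields a crown. *)
Lemma closed_nbhd_sub (V : finType) (E : {set {set V}}) (e : {set V}) (a c : V) :
  linear3graph E -> copy_free crown E -> e \in E -> a \in e -> c \in e ->
  {in e, forall v, degree E v = 5} -> closed_nbhd E a \subset closed_nbhd E c.
Proof.
move=> lE free eE ae ce d5; apply/subsetP => w wa.
have [->//|ca] := eqVneq c a.
have [we|we] := boolP (w \in e).
  by rewrite inE; apply/exists_inP; exists e; rewrite // ce.
have [b' [c' [uabc' defe']]] := card3_remove (edge_card lE eE) ae.
have [b uabc defe] : exists2 b, uniq [:: a; b; c] & e = [set a; b; c].
  move: ce; rewrite defe' !inE (negPf ca) /= => /orP[/eqP cb|/eqP->]; last by exists b'.
  exists c'; last by rewrite cb setUAC.
  by move: uabc'; rewrite cb /= !inE !negb_or ![c' == _]eq_sym [_ && (a != c')]andbC.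
move: wa; rewrite inE => /exists_inP[A AE /andP[aA wA]].
apply: contraNT free => wc.
have wa : w != a by apply: contraNneq we => ->.
rewrite defe in eE.
apply: (@extend_to_crown V E A [set w] a b c lE uabc eE AE _ aA).
- by apply: contraNneq we => eA; rewrite defe -eA.
- by rewrite sub1set !inE wa.
- by rewrite disjoints1.
- by rewrite d5 // defe !inE eqxx orbT.
- by rewrite d5 // cards1.
Qed.

Lemma sum_degree (V : finType) (E : {set {set V}}) (S : {set V}) :
  \sum_(v in S) degree E v = \sum_(e in E) #|e :&: S|.
Proof.
under eq_bigr do rewrite /degree -sum1_card.
under [RHS]eq_bigr do rewrite -sum1_card.
rewrite (exchange_big_dep (mem E)) /=; last by move=> v e _; rewrite inE => /andP[].
by apply: eq_bigr => e eE; apply: eq_bigl => v; rewrite !inE eE andbC.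
Qed.

Lemma card_closed_nbhd (V : finType) (E : {set {set V}}) (v : V) :
  linear3graph E -> 0 < degree E v -> #|closed_nbhd E v| = (degree E v).*2.+1.
Proof.
move=> lE dv; set S := closed_nbhd E v; pose F := [set e in E | v \in e].
have vS : v \in S.
  have /card_gt0P[e] := dv; rewrite !inE => /andP[eE ve].
  by apply/exists_inP; exists e; rewrite // ve.
(* Incidences with the edges through [v] are counted twice: [v] lies on all of them, every other
   vertex of [S] on exactly one by linearity. *)
have : \sum_(w in S) degree F w = \sum_(e in F) 3.
  rewrite sum_degree; apply: eq_bigr => e; rewrite inE => /andP[eE ve].
  rewrite (setIidPl _) ?(edge_card lE eE) //; apply/subsetP => w we.
  by rewrite inE; apply/exists_inP; exists e; rewrite // ve.
rewrite sum_nat_const (bigD1 v) //=.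
have -> : degree F v = degree E v.
  by congr #|pred_of_set _|; apply/setP => e; rewrite !inE -andbA andbb.
rewrite (eq_bigr (fun=> 1)) => [|w /andP[+ wv]]; last first.
  rewrite inE => /exists_inP[e eE /andP[ve we]].
  rewrite /degree (_ : [set _ in _ | _] = [set e]) ?cards1 //; apply/setP => f.
  rewrite !inE; apply/andP/eqP => [[/andP[fE vf] wf]|->]; last by rewrite eE ve.
  by apply: (linear_edge_eq lE fE eE wv).
rewrite sum1dep_card (_ : [set w | _] = S :\ v); last first.
  by apply/setP => w; rewrite in_setD1 in_set andbC.
rewrite (cardsD1 v S) vS add1n -/(degree E v) -mul2n => sumE; congr _.+1.
by apply/eqP; rewrite -(eqn_add2l (degree E v)) sumE mulnC.
Qed.

(* A Steiner triple system on 11 points would have 55/3 edges. *)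
Lemma no_crown_free_5regular (V : finType) (E : {set {set V}}) (e0 : {set V}) :
  linear3graph E -> copy_free crown E -> e0 \in E ->
  ~ (forall e v, e \in E -> v \in e -> degree E v = 5).
Proof.
move=> lE free e0E d5.
have /card_gt0P[v ve0] : 0 < #|e0| by rewrite (edge_card lE e0E).
have dv := d5 _ _ e0E ve0; set S := closed_nbhd E v.
have cS : #|S| = 11 by rewrite card_closed_nbhd // dv.
have SP u : u \in S -> exists e, [/\ e \in E, v \in e & u \in e].
  by rewrite inE => /exists_inP[e eE /andP[]]; exists e.
(* [S] is a union of components: neighbours of a neighbour of [v] are neighbours of [v]. *)
have subS e u : u \in S -> e \in E -> u \in e -> e \subset S.
  case/SP=> f [fE vf uf] eE ue; apply: subset_trans (_ : closed_nbhd E u \subset _).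
    apply/subsetP => w we; rewrite inE.
    by apply/exists_inP; exists e; rewrite // ue.
  by apply: (closed_nbhd_sub lE free fE) => // x; apply: d5.
have : \sum_(u in S) degree E u = \sum_(u in S) 5.
  by apply: eq_bigr => u /SP[e [eE _ ue]]; apply: d5 ue.
rewrite sum_degree sum_nat_const cS => sumE.
(* Every edge meets [S] in 0 or 3 vertices, so 3 divides the number of incidences. *)
suff: 3 %| 11 * 5 by [].
rewrite -sumE; apply: dvdn_sum => e eE.
have [->|[u]] := set_0Vmem (e :&: S); first by rewrite cards0.
rewrite inE => /andP[ue uS].
by rewrite (setIidPl (subS e u uS eE ue)) (edge_card lE eE).
Qed.

(** * Weights of edges and the final count *)

Lemma sorted_triple (T : finType) (A : {set T}) (f : T -> nat) : #|A| = 3 ->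
  exists a b c, [/\ uniq [:: a; b; c], A = [set a; b; c] & f a <= f b <= f c].
Proof.
move=> A3; set s := sort (relpre f leq) (enum A).
have ss : sorted (relpre f leq) s by apply: sort_sorted => x y; apply: leq_total.
have us : uniq s by rewrite sort_uniq enum_uniq.
have ms x : (x \in s) = (x \in A) by rewrite mem_sort mem_enum.
have sz : size s = 3 by rewrite size_sort -cardE.
case: s ss us ms sz => [|a [|b [|c []]]] //= ss us ms _; exists a, b, c.
by split=> //; [apply/setP => x; rewrite -ms !inE orbA | rewrite andbT in ss].
Qed.

Local Open Scope ring_scope.

(** The sum is at least 1 if [a = 1], and at least 2/3 if [b <= 3]. Otherwise [c <= 5], and [a <= 4]
    gives at least 1/4 + 2/5 = 13/20. *)
Lemma degree_weight (a b c : nat) : (0 < a)%N -> (a <= b <= c)%N ->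
  ~~ [&& (1 < a)%N, (3 < b)%N & (5 < c)%N] ->
  3%:R / 5%:R < a%:R^-1 + b%:R^-1 + c%:R^-1 :> rat \/ [/\ a = 5, b = 5 & c = 5]%N.
Proof.
move=> a0 /andP[ab bc] no.
have b0 := leq_trans a0 ab; have c0 := leq_trans b0 bc.
have inv_ge k m : (0 < k)%N -> (k <= m)%N -> m%:R^-1 <= k%:R^-1 :> rat.
  move=> k0 km; rewrite lef_pV2 ?ler_nat // posrE ltr0n //.
  exact: leq_trans km.
have pos m : (0 < m)%N -> 0 < m%:R^-1 :> rat by move=> m0; rewrite invr_gt0 ltr0n.
have [pa pb pc] := And3 (pos a a0) (pos b b0) (pos c c0).
have [a1|a1] := leqP a 1; first by left; have := inv_ge _ _ a0 a1; lra.
have [b3|b3] := leqP b 3.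
  by left; have := inv_ge _ _ b0 b3; have := inv_ge _ _ a0 (leq_trans ab b3); lra.
have c5 : (c <= 5)%N by move: no; rewrite a1 b3 /= -leqNgt.
have b5 := leq_trans bc c5; have ic := inv_ge _ _ c0 c5; have ib := inv_ge _ _ b0 b5.
have [a4|a4] := leqP a 4.
  by left; have := inv_ge _ _ a0 a4; lra.
by right; split; lia.
Qed.

Lemma edge_weight (V : finType) (E : {set {set V}}) (e : {set V}) :
  linear3graph E -> copy_free crown E -> e \in E ->
  let w : rat := \sum_(v in e) (degree E v)%:R^-1 in
  3%:R / 5%:R < w \/ w = 3%:R / 5%:R /\ {in e, forall v, degree E v = 5}.
Proof.
move=> lE free eE w.
have [a [b [c [uabc defe sabc]]]] := sorted_triple (degree E) (edge_card lE eE).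
have -> : w = (degree E a)%:R^-1 + (degree E b)%:R^-1 + (degree E c)%:R^-1.
  rewrite /w defe (eq_bigl [in [:: a; b; c]]) => [|x]; last by rewrite !inE orbA.
  by rewrite -big_uniq //= !big_cons big_nil addr0 addrA.
have da : (0 < degree E a)%N.
  by apply/card_gt0P; exists e; rewrite inE eE defe !inE eqxx.
case: (degree_weight da sabc) => [|lt|[a5 b5 c5]]; first 1 last.
- by left.
- right; rewrite a5 b5 c5; split; first lra.
  by move=> x; rewrite defe !inE -orbA => /or3P[]/eqP->.
apply: contraNN free => /and3P[a2 b4 c6].
by apply: (crown_of_degrees lE uabc _ a2 b4 c6); rewrite -defe.
Qed.

Lemma sum_weight_le (V : finType) (E : {set {set V}}) :
  \sum_(e in E) \sum_(v in e) (degree E v)%:R^-1 <= #|V|%:R :> rat.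
Proof.
rewrite (exchange_big_dep predT) //= -sum1_card natr_sum.
apply: ler_sum => v _; rewrite (eq_bigl [in [set e in E | v \in e]]) => [|e].
  rewrite sumr_const -/(degree E v) -[_ *+ _]mulr_natr.
  (* A vertex contributes its degree times the inverse: 1, or 0 if it is isolated. *)
  have [->|d0] := eqVneq (degree E v) 0%N; first by rewrite mulr0.
  by rewrite mulVf ?pnatr_eq0.
by rewrite !inE.
Qed.

Lemma crown_free_edge_bound (V : finType) (E : {set {set V}}) :
  linear3graph E -> copy_free crown E -> (3 * #|E| < 5 * #|V|)%N.
Proof.
move=> lE free.
have V0 : (0 < #|V|)%N by case/and3P: lE.
have [->|[e0 e0E]] := set_0Vmem E; first by rewrite cards0 muln0 muln_gt0 V0.
pose w (e : {set V}) : rat := \sum_(v in e) (degree E v)%:R^-1.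
have [/exists_inP[e1 e1E we1]|/exists_inPn none] :=
    boolP [exists e in E, 3%:R / 5%:R < w e]; last first.
  exfalso; apply: (no_crown_free_5regular lE free e0E) => e v eE ve.
  by case: (edge_weight lE free eE) => [|[_]]; [rewrite (negPf (none e eE)) | exact].
have w_ge e : e \in E -> 3%:R / 5%:R <= w e.
  by case/(edge_weight lE free) => [/ltW//|[<-]].
have : \sum_(e in E) (3%:R / 5%:R) < \sum_(e in E) w e.
  rewrite (bigD1 e1) //= [ltRHS](bigD1 e1) //=; apply: ltr_leD => //.
  by apply: ler_sum => e /andP[/w_ge].
move/lt_le_trans/(_ (sum_weight_le E)); rewrite sumr_const -mulr_natr => lt.
by rewrite -(ltr_nat rat) !natrM; lra.
Qed.

Local Close Scope ring_scope.

Theorem theorem1p1 (n : nat) (hn : 1 <= n) :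
  ((linear_turan n crown)%:R < 5%:R * n%:R / 3%:R :> rat)%R /\
  (forall (V : finType) (E : {set {set V}}),
     linear3graph E -> #|V| = n -> copy_free crown E ->
     (#|E|%:R < 5%:R * n%:R / 3%:R :> rat)%R).
Proof.
have toQ m : 3 * m < 5 * n -> (m%:R < 5%:R * n%:R / 3%:R :> rat)%R.
  by rewrite -(ltr_nat rat) !natrM; lra.
split=> [|V E lE cV free]; apply: toQ; last by rewrite -cV crown_free_edge_bound.
(* The bound must also hold for 0, the value of an empty maximum; this is where [1 <= n] enters. *)
rewrite /linear_turan; elim/big_ind: _ => [|x y hx hy|E /andP[lE free]].
- by rewrite muln0 muln_gt0.
- by rewrite /maxn; case: ifP.
- by have := crown_free_edge_bound lE free; rewrite card_ord.
Qed.
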